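(* Let $W$ be an $r\times c$ grid storage area, let $n=rc$, let $D=(d_1,\dots,d_n)$ be a departure sequence (an ordering of the $n$ loads), and let $k\ge 0$ be an integer. An arrangement $\mathcal A$ of the $n$ loads in $W$ is $k$-robust for $D$ if and only if for every $i\in\{1,\dots,n\}$ the load $d_i$ is either in the bottom row of $W$ or is adjacent in $\mathcal A$ to a load $d_j$ with $i-j\ge k+1$.
   Context: Storage area. $W$ is a rectangular grid of cells with $r$ rows and $c$ columns; each cell holds at most one load. The bottom row is the open side of $W$: below it lies an additional row of $c$ cells, the I/O row, each of whose cells is adjacent to the bottom-row cell directly above it (and to its horizontal neighbors in the I/O row). Loads leave $W$ only through the I/O row, which holds no stored loads. An arrangement of the loads is an injective map from the set of loads to the cells of $W$. Two loads are adjacent in an arrangement if they are located in horizontally or vertically adjacent cells of $W$. A retrieval action moves a load from its cell in $W$ along a path of otherwise empty cells (steps in the four cardinal directions, inside $W$ together with the I/O row) to some cell of the I/O row, after which the load disappears. An arrangement $\mathcal A$ satisfies a departure sequence $D$ if, starting from $\mathcal A$, all loads can be retrieved in the order specified by $D$ with exactly one action (a retrieval action) per load. A permutation $\tilde S$ of a sequence $S=(s_1,\dots,s_n)$ of distinct elements is a $k$-bounded perturbation of $S$ if for every $i<j$ such that $s_j$ appears before $s_i$ in $\tilde S$ one has $j-i\le k$. An arrangement $\mathcal A$ is $k$-robust for a departure sequence $D$ if $\mathcal A$ satisfies every $k$-bounded perturbation $\tilde D$ of $D$. *)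

(* Defs.v *)
From mathcomp Require Import all_boot.

Set Implicit Arguments.
Unset Strict Implicit.
Unset Printing Implicit Defensive.

(** A cell is a pair (row, column). In the storage area [W] itself, row [0] is
    the bottom row, i.e. the open side. *)
Definition cell (r c : nat) : Type := ('I_r * 'I_c)%type.

Definition consecutive (a b : nat) : bool := (a.+1 == b) || (b.+1 == a).

Definition cell_adj (r c : nat) : rel (cell r c) :=
  fun u v => ((u.1 == v.1) && consecutive u.2 v.2)
          || (consecutive u.1 v.1 && (u.2 == v.2)).

(** [W] together with the I/O row is a grid with one more row: there, row [0] is
    the I/O row, and row [i] of [W] becomes row [i.+1]. *)
Definition in_W_io (r c : nat) (u : cell r c) : cell r.+1 c :=
  (lift ord0 u.1, u.2).

Definition io_cell (r c : nat) (u : cell r.+1 c) : bool := u.1 == ord0.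

Section Retrieval.

Variables (r c : nat) (L : finType).
Implicit Types (A : L -> cell r c) (R : {set L}) (x y : L).

Definition arrangement A : Prop := injective A.

Definition in_bottom_row A x : bool := (A x).1 == 0 :> nat.

Definition adjacent A x y : bool := cell_adj (A x) (A y).

(** [R] is the set of loads currently stored, each of them at its cell in [A].
    The path is the start cell [A x] followed by [p]. *)
Definition retrievable A R x : Prop :=
  exists p : seq (cell r.+1 c),
    [/\ path (@cell_adj r.+1 c) (in_W_io (A x)) p,
        forall y, y \in R -> y != x -> in_W_io (A y) \notin p
      & io_cell (last (in_W_io (A x)) p)].

Fixpoint satisfies_from A R (D : seq L) : Prop :=
  if D is x :: D' then
    [/\ x \in R, retrievable A R x & satisfies_from A (R :\ x) D']
  else R = set0.

Definition satisfies A (D : seq L) : Prop := satisfies_from A [set: L] D.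

Definition departure_sequence (n : nat) (D : n.-tuple L) : Prop :=
  uniq D /\ forall x, x \in D.

Definition bounded_perturbation (k n : nat) (S S' : n.-tuple L) : Prop :=
  perm_eq S' S /\
  forall i j : 'I_n, i < j ->
    index (tnth S j) S' < index (tnth S i) S' -> j - i <= k.

Definition robust (k n : nat) A (D : n.-tuple L) : Prop :=
  forall D' : n.-tuple L, bounded_perturbation k D D' -> satisfies A D'.

End Retrieval.

(* Main.v *)
Require Import Defs.
From mathcomp Require Import all_boot.
From mathcomp Require Import zify.

Set Implicit Arguments.
Unset Strict Implicit.
Unset Printing Implicit Defensive.

(** Sufficiency: when [d_i] is due, the loads [d_j] with [i - j > k] have already
    left, so following the neighbours given by the condition yields an empty path
    whose indices decrease until the bottom row is reached. Necessity: if the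
    condition fails at [d_i], retrieve [d_i] earlier by [k] positions; as [W] is
    full, at that moment all neighbours of [d_i] are still present and block it. *)

Lemma in_W_io_inj (r c : nat) : injective (@in_W_io r c).
Proof.
move=> [a b] [a' b'] eq_u; congr pair; last exact: (congr1 snd eq_u).
exact: lift_inj (congr1 fst eq_u).
Qed.

Lemma cell_adj_in_W_io (r c : nat) (u v : cell r c) :
  cell_adj (in_W_io u) (in_W_io v) = cell_adj u v.
Proof.
by rewrite /cell_adj /in_W_io /consecutive /= (inj_eq (@lift_inj _ _)) /bump !add1n !eqSS.
Qed.

Lemma io_cellPn (r c : nat) (u : cell r.+1 c) :
  ~~ io_cell u -> exists v : cell r c, u = in_W_io v.
Proof.
case: u => a b; rewrite /io_cell /=; case: (unliftP ord0 a) => [a' ->|-> //].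
by exists (a', b).
Qed.

Lemma cell_adj_io (r c : nat) (u : cell r c) (v : cell r.+1 c) :
  cell_adj (in_W_io u) v -> io_cell v -> u.1 == 0 :> nat.
Proof.
case: v => a b; rewrite /io_cell /cell_adj /consecutive /= => uv /eqP a0.
by move: uv; rewrite a0 /bump /=; lia.
Qed.

Lemma cell_adj_irrefl (r c : nat) : irreflexive (@cell_adj r c).
Proof. by move=> u; rewrite /cell_adj /consecutive; lia. Qed.

Section Retrieval.

Variables (r c : nat) (L : finType) (A : L -> cell r c).
Implicit Types (R : {set L}) (x y : L).

Lemma retrievable_bottom R x : in_bottom_row A x -> retrievable A R x.
Proof.
move=> xb; exists [:: (ord0, (A x).2)]; split=> //=.
by rewrite andbT /cell_adj /consecutive /= /bump (eqP xb) eqxx.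
Qed.

(** The load [x] steps into the vacated cell of [y] and then follows the path of [y]. Since [y] is
    not in [R], that path avoids every load of [R]. *)
Lemma retrievable_adjacent R x y :
  injective A -> y \notin R -> adjacent A x y ->
  retrievable A R y -> retrievable A R x.
Proof.
move=> A_inj yR xy [p [p_path p_free p_io]].
exists (in_W_io (A y) :: p); split=> //=.
  by rewrite cell_adj_in_W_io; apply/andP.
move=> z zR _; have zy : z != y by apply: contraNneq yR => <-.
by rewrite inE negb_or (inj_eq (@in_W_io_inj _ _)) (inj_eq A_inj) zy p_free.
Qed.

(** Only the first step of the path matters: it enters either the I/O row or a cell of [W] without
    another load. An empty path would not reach the I/O row. *)
Lemma retrievable_empty_neighbor R x :
  retrievable A R x ->
  in_bottom_row A x \/
  exists2 v, cell_adj (A x) v & forall y, y \in R -> y != x -> A y != v.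
Proof.
case=> [[|v p] [/= p_path p_free p_io]] //.
case/andP: p_path => xv _; have [v_io|/io_cellPn[w vw]] := boolP (io_cell v).
  by left; apply: cell_adj_io xv v_io.
right; exists w; first by rewrite -cell_adj_in_W_io -vw.
move=> y yR yx; apply: contraNneq (p_free y yR yx) => ->.
by rewrite vw mem_head.
Qed.

Lemma satisfies_from_retrievable R (s1 s2 : seq L) x :
  satisfies_from A R (s1 ++ x :: s2) ->
  retrievable A (R :\: [set y in s1]) x.
Proof.
elim: s1 R => [|y s1 IH] R /=; first by rewrite set_nil setD0; case.
by case=> _ _ /IH; rewrite setDDl set_cons.
Qed.

(** The prefix [s1] of loads already retrieved lets the induction on [s2] keep a hypothesis about
    the whole sequence. *)
Lemma satisfies_from_suffix (s1 s2 : seq L) :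
  uniq (s1 ++ s2) ->
  (forall t1 x t2, s1 ++ s2 = t1 ++ x :: t2 ->
     retrievable A [set y in x :: t2] x) ->
  satisfies_from A [set y in s2] s2.
Proof.
elim: s2 s1 => [|x s2 IH] s1 s_uniq s_retr /=; first exact: set_nil.
split; [by rewrite inE mem_head | exact: s_retr erefl |].
have -> : [set y in x :: s2] :\ x = [set y in s2].
  move: s_uniq; rewrite cat_uniq /= => /and4P[_ _ xs2 _].
  apply/setP=> y; rewrite !inE; case: eqVneq => [->|//].
  by rewrite (negPf xs2).
by apply: (IH (rcons s1 x)); rewrite cat_rcons.
Qed.

Lemma retrievable_of_earlier_gone (k n : nat) (D : n.-tuple L) R (i : 'I_n) :
  injective A ->
  (forall i : 'I_n, in_bottom_row A (tnth D i) \/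
     exists j : 'I_n, adjacent A (tnth D i) (tnth D j) /\ k.+1 <= i - j) ->
  (forall j : 'I_n, k < i - j -> tnth D j \notin R) ->
  retrievable A R (tnth D i).
Proof.
move=> A_inj D_cond; have [m] := ubnP (i : nat).
(* Strong induction on [i]. The hypothesis [gone] passes to the neighbour index [j], because [j < i]
   makes [k < j - l] imply [k < i - l]. *)
elim: m i => // m IH i le_im gone.
have [/retrievable_bottom //|[j [ij lt_k]]] := D_cond i.
apply: retrievable_adjacent ij _ => //; first exact: gone.
by apply: IH => [|l lt_l]; [lia | apply: gone; lia].
Qed.

End Retrieval.

(** For [m <= i], the entry at position [i] jumps ahead to position [m]. Writing it as
    [take 1 (drop i s)] avoids a default element. *)
Definition advance (T : Type) (m i : nat) (s : seq T) : seq T :=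
  take m s ++ take 1 (drop i s) ++ drop m (take i s) ++ drop i.+1 s.

Lemma perm_advance (T : eqType) (m i : nat) (s : seq T) :
  m <= i -> perm_eq (advance m i s) s.
Proof.
move=> le_mi; rewrite /advance perm_sym.
rewrite -{1}(cat_take_drop i s) -{1}(cat_take_drop m (take i s)) take_takel //.
rewrite -catA perm_cat2l -{1}(cat_take_drop 1 (drop i s)) drop_drop add1n.
by rewrite perm_catCA.
Qed.

Lemma index_advance (T : eqType) (x0 : T) (m i l : nat) (s : seq T) :
  uniq s -> m <= i < size s -> l < size s ->
  index (nth x0 s l) (advance m i s) =
    if l == i then m else if m <= l < i then l.+1 else l.
Proof.
move=> s_uniq /andP[le_mi lt_i] lt_l; set f := if l == i then _ else _.
have s_perm := perm_advance s le_mi.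
have f_size : f < size (advance m i s).
  by rewrite (perm_size s_perm) /f; do 2?case: ifP; lia.
(* As entries are distinct, it suffices to read off the entry at the claimed position [f]. *)
suff <- : nth x0 (advance m i s) f = nth x0 s l.
  by rewrite index_uniq // (perm_uniq s_perm).
rewrite /advance (drop_nth x0 lt_i) [take 1 _]/= take0 !nth_cat size_take.
rewrite size_drop size_take lt_i (leq_ltn_trans le_mi lt_i) /f {f f_size} /=.
case: (eqVneq l i) => [->|ne_li]; first by rewrite ltnn subnn.
case: (boolP (m <= l < i)) => [/andP[le_ml lt_li]|l_out].
  do 2![rewrite ifF; last by lia]; rewrite ifT; last by lia.
  by rewrite nth_drop nth_take; first congr nth; lia.
case: (ltnP l m) => [lt_lm|le_ml]; first by rewrite nth_take.
do 2![rewrite ifF; last by lia].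
by rewrite nth_drop; congr nth; lia.
Qed.

(** The only inverted pairs consist of [d_i] and one of the at most [k] entries it overtakes.
    Truncated subtraction sends [d_i] to the front when [i < k]. *)
Lemma advance_bounded_perturbation (k n : nat) (L : finType)
    (D D' : n.-tuple L) (i : 'I_n) :
  uniq D -> tval D' = advance (i - k) i D -> bounded_perturbation k D D'.
Proof.
move=> D_uniq D'E; split; rewrite D'E; first exact/perm_advance/leq_subr.
move=> a b lt_ab; have x0 := tnth D i; rewrite !(tnth_nth x0).
have lt_a := ltn_ord a; have lt_b := ltn_ord b; have lt_i := ltn_ord i.
rewrite !index_advance ?size_tuple ?leq_subr //.
by do 4?case: ifP; lia.
Qed.

Lemma bounded_perturbation_gone (k n : nat) (L : finType)
    (D D' : n.-tuple L) (i j : 'I_n) (s1 s2 : seq L) :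
  uniq D -> bounded_perturbation k D D' ->
  tval D' = s1 ++ tnth D i :: s2 -> k < i - j -> tnth D j \notin tnth D i :: s2.
Proof.
move=> D_uniq [D_perm D_bound] D'E lt_k; apply/negP => j_in.
have D'_uniq : uniq (s1 ++ tnth D i :: s2) by rewrite -D'E (perm_uniq D_perm).
suff: i - j <= k by rewrite leqNgt lt_k.
apply: D_bound; first by lia.
have ne_ij : tnth D i != tnth D j.
  apply/negP=> /eqP/(tuple_uniqP _ D_uniq) eq_ij.
  by move: lt_k; rewrite eq_ij subnn.
(* Neither load occurs in [s1], so [d_i] has index [size s1] in [D'] and [d_j] a larger one: an
   inverted pair. *)
move: D'_uniq; rewrite D'E cat_uniq => /and3P[_ /hasPn s1_out _].
have j_s1 := s1_out _ j_in; have i_s1 := s1_out _ (mem_head _ _).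
by rewrite !index_cat (negPf j_s1) (negPf i_s1) /= eqxx (negPf ne_ij) addn0; lia.
Qed.

Theorem proposition1 (r c n k : nat) (hn : n = r * c)
    (L : finType) (hL : #|L| = n)
    (D : n.-tuple L) (hD : departure_sequence D)
    (A : L -> cell r c) (hA : arrangement A) :
  robust k A D <->
  (forall i : 'I_n,
     in_bottom_row A (tnth D i) \/
     exists j : 'I_n, adjacent A (tnth D i) (tnth D j) /\ k.+1 <= i - j).
Proof.
case: hD => D_uniq D_all; split=> [D_robust i | D_cond D' D'_bound].
- have size_adv : size (advance (i - k) i D) == n.
    by rewrite (perm_size (perm_advance _ (leq_subr _ _))) size_tuple.
  have /D_robust : bounded_perturbation k D (Tuple size_adv).
    exact: (@advance_bounded_perturbation _ _ _ _ _ i).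
  rewrite /satisfies /= /advance (drop_nth (tnth D i)) ?size_tuple //.
  rewrite -tnth_nth /= take0 => /satisfies_from_retrievable.
  case/retrievable_empty_neighbor=> [|[v iv v_free]]; [by left | right].
  (* Fullness of [W]: an injection of [r * c] loads into [r * c] cells is onto, so [v] holds a
     load. *)
  have /codomP[y yv] : v \in codom A.
    by rewrite inj_card_onto // card_prod !card_ord hL hn.
  have /tnthP[j yj] := D_all y; exists j; rewrite /adjacent -yj -yv.
  split=> //; rewrite ltnNge; apply/negP=> le_k.
  (* If [i - j <= k], then [d_j] is not among the first [i - k] entries of [D], so it is still
     stored and [v] is not free. *)
  suff: A y != v by rewrite yv eqxx.
  apply: v_free; last first.
    by apply: contraTneq iv => yi; rewrite yv yi cell_adj_irrefl.
  rewrite !inE andbT yj (tnth_nth (tnth D i)) in_take ?size_tuple //.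
  by rewrite index_uniq ?size_tuple //; lia.
- have D'_perm := D'_bound.1.
  have -> : satisfies A D' = satisfies_from A [set y in D'] D'.
    congr satisfies_from; apply/setP=> y.
    by rewrite !inE (perm_mem D'_perm) D_all.
  apply: (@satisfies_from_suffix _ _ _ _ [::]) => [|t1 x t2 /= D'E].
    by rewrite (perm_uniq D'_perm).
  have /tnthP[i xi] := D_all x; move: D'E; rewrite xi => D'E.
  apply: retrievable_of_earlier_gone D_cond _ => // j lt_k; rewrite inE.
  exact: bounded_perturbation_gone D'_bound D'E lt_k.
Qed.
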